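(* Fix the structure vector $\boldsymbol{\ell}=(\ell_1,\dots,\ell_{\mathcal K})$ and $A>0$. There exist constants $C^{(7)},C^{(8)}$, depending only on $\boldsymbol\ell$ and $A$, such that the following holds. Let $\mathbf{x}\in\mathbb{C}^{R}$ be a data point with $|z_j|=1$, $a_{\ell_j-1,j}\ne 0$ for $j=1,\dots,\mathcal K$, $\eta(\mathbf{x})>0$, and $|a_{\ell,j}|\le A$ for all $\ell,j$. Let $\eta^*=\max_{r\ne j}|\arg z_j-\arg z_r|$, let $N\ge R$, and assume that $N\eta^*<\pi R$. Then the condition numbers of the decimated system with parameter $p^*=\lfloor N/R\rfloor$ satisfy, for every $j=1,\dots,\mathcal K$, $$\kappa^{(p^* )}_{L_j+\ell}(\mathbf{x})\le C^{(7)}\cdot\left(\frac{1}{\eta^{(j)}}\right)^{R-\ell}\left(1+\frac{|a_{\ell-1,j}|}{|a_{\ell_j-1,j}|}\right)\cdot\frac{1}{N^{R+1-\max_i\ell_i}},\qquad \ell=0,\dots,\ell_j-1,$$ $$\kappa^{(p^* )}_{L_j+\ell_j}(\mathbf{x})\le C^{(8)}\cdot\left(\frac{1}{\eta^{(j)}}\right)^{R-\ell_j}\frac{1}{|a_{\ell_j-1,j}|}\cdot\frac{1}{N^{R+1-\max_i\ell_i}}.$$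
   Context: Let $\mathcal K\ge 2$ and let $\boldsymbol{\ell}=(\ell_1,\dots,\ell_{\mathcal K})$ be a vector of positive integers (the problem structure vector). Put $R=\sum_{i=1}^{\mathcal K}\ell_i+\mathcal K$ and $L_j=1+\sum_{m=1}^{j-1}(\ell_m+1)$. A data point is a vector $\mathbf{x}=(a_{0,1},\dots,a_{\ell_1-1,1},z_1,\dots,a_{0,\mathcal K},\dots,a_{\ell_{\mathcal K}-1,\mathcal K},z_{\mathcal K})^T\in\mathbb{C}^R$, so that $a_{\ell,j}$ is the coordinate number $L_j+\ell$ and $z_j$ is the coordinate number $L_j+\ell_j$. Put $a_{-1,j}:=0$. For a positive integer $p$ (the decimation parameter), the decimated forward map $\mathcal{P}^{(p)}:\mathbb{C}^R\to\mathbb{C}^R$ is $\mathcal{P}^{(p)}(\mathbf{x})=(n_0,\dots,n_{R-1})$, where $$n_k=\sum_{j=1}^{\mathcal K}z_j^{pk}\sum_{\ell=0}^{\ell_j-1}(a_{\ell,j}p^\ell)k^\ell,\qquad k=0,\dots,R-1$$ (with $0^0=1$). $\mathcal{J}^{(p)}(\mathbf{x})$ is its $R\times R$ Jacobian matrix. At points where it is invertible, the decimated condition numbers are, for $\alpha=1,\dots,R$, $$\kappa^{(p)}_\alpha(\mathbf{x})=\sum_{i=1}^R\left|\left(\mathcal{J}^{(p)}(\mathbf{x})^{-1}\right)_{\alpha,i}\right|\,|n_{i-1}|.$$ For $|z_j|=1$, $\eta^{(j)}=\min_{r\ne j}|\arg z_r-\arg z_j|$ and $\eta(\mathbf{x})=\min_j\eta^{(j)}$.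 All angular differences (including those in $\eta^*$) are measured modulo $2\pi$, so that they lie in $[0,\pi]$. *)

(* Defs.v *)
From HB Require Import structures.
From mathcomp Require Import all_boot all_order all_algebra.
From mathcomp Require Import complex.
From mathcomp Require Import all_classical all_reals all_analysis.
Import Order.TTheory GRing.Theory Num.Theory.
Import numFieldNormedType.Exports.
Import Normc.

Set Implicit Arguments.
Unset Strict Implicit.
Unset Printing Implicit Defensive.

Local Open Scope ring_scope.
Local Open Scope complex_scope.

Section Angles.
Variable R : realType.
Implicit Types z w : R[i].

(* Principal argument, with values in ]-pi, pi]; see [cargK] and [carg_itv]. *)
Definition carg z : R :=
  let t := acos (complex.Re z / normc z) in
  if 0 <= complex.Im z then t else - t.

Lemma carg_itv z : normc z = 1 -> - pi < carg z <= pi.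
Proof.
case: z => a b /=; rewrite /carg /= => h.
rewrite h divr1; move/(congr1 (fun t => t ^+ 2)): h.
rewrite sqr_sqrtr ?addr_ge0 ?sqr_ge0 // expr1n => h.
have a1 : -1 <= a <= 1.
  by rewrite -ler_norml -(expr_le1 (n := 2)) // real_normK ?num_real //
             -h lerDl sqr_ge0.
case: (leP 0 b) => b0.
  by rewrite acos_lepi // (lt_le_trans _ (acos_ge0 a1)) // oppr_lt0 pi_gt0.
rewrite (le_trans _ (pi_ge0 R)) ?oppr_le0 ?acos_ge0 // andbT ltrN2 acos_ltpi //.
case/andP: a1 => a1 ->; rewrite andbT lt_neqAle a1 andbT.
apply: contra_eq_neq h => <-; rewrite sqrrN expr1n.
by rewrite -subr_eq0 addrAC subrr add0r sqrf_eq0 lt_eqF.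
Qed.

Lemma cargK z : normc z = 1 -> cos (carg z) +i* sin (carg z) = z.
Proof.
case: z => a b /=; rewrite /carg /= => h.
rewrite h divr1; move/(congr1 (fun t => t ^+ 2)): h.
rewrite sqr_sqrtr ?addr_ge0 ?sqr_ge0 // expr1n => h.
have a1 : -1 <= a <= 1.
  by rewrite -ler_norml -(expr_le1 (n := 2)) // real_normK ?num_real //
             -h lerDl sqr_ge0.
have -> : sin (if 0 <= b then acos a else - acos a) = b.
  case: (leP 0 b) => b0; rewrite ?sinN sin_acos // -h addrAC subrr add0r sqrtr_sqr.
    by rewrite ger0_norm.
  by rewrite ltr0_norm // opprK.
by case: ifP => _; rewrite ?cosN acosK.
Qed.

(* |arg z - arg w| measured modulo 2 pi, with values in [0, pi]. *)
Definition angdist z w : R :=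
  let d := `|carg z - carg w| in Num.min d (2 * pi - d).

End Angles.

Section Prony.
Variables (R : realType) (K : nat) (ell : 'I_K -> nat).

(* Dimension of the data space, written R in the mathematics. *)
Definition data_dim : nat := (\sum_(i < K) ell i + K)%N.

(* Zero-based position of the first coordinate of block j, i.e. L_j - 1. *)
Definition offset (j : 'I_K) : nat := (\sum_(m < K | (m < j)%N) (ell m).+1)%N.

Lemma data_coord_proof (j : 'I_K) (l : 'I_(ell j).+1) : (offset j + l < data_dim)%N.
Proof.
have -> : data_dim = (\sum_(m < K) (ell m).+1)%N.
  rewrite /data_dim; under [RHS]eq_bigr => m _ do rewrite -addn1.
  by rewrite big_split /= sum1_card card_ord.
rewrite (bigID (fun m : 'I_K => (m < j)%N)) /= ltn_add2l.
by rewrite (bigD1 j) ?ltnn //= (leq_trans (ltn_ord l)) // leq_addr.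
Qed.

(* The coordinate number L_j + l; only meaningful for l <= ell j. *)
Definition data_coord (j : 'I_K) (l : nat) : 'I_data_dim :=
  Ordinal (data_coord_proof (inord l : 'I_(ell j).+1)).

Lemma data_coordE (j : 'I_K) (l : nat) :
  (l <= ell j)%N -> data_coord j l = (offset j + l)%N :> nat.
Proof. by move=> lj; rewrite /data_coord /= inordK. Qed.

Implicit Type x : 'rV[R[i]]_data_dim.

(* The amplitude a_{l,j}, for l < ell j. *)
Definition amp x (j : 'I_K) (l : nat) : R[i] := x 0 (data_coord j l).

(* a_{l-1,j}, with the convention a_{-1,j} = 0. *)
Definition amp_prev x (j : 'I_K) (l : nat) : R[i] :=
  if l is l'.+1 then amp x j l' else 0.

(* a_{ell_j - 1, j} *)
Definition amp_top x (j : 'I_K) : R[i] := amp x j (ell j).-1.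

Definition node x (j : 'I_K) : R[i] := x 0 (data_coord j (ell j)).

Definition decimated_map (p : nat) x : 'rV[R[i]]_data_dim :=
  \row_(k < data_dim) \sum_(j < K) node x j ^+ (p * k) *
    \sum_(l < ell j) (amp x j l * p%:R ^+ l) * k%:R ^+ l.

(* The library's [jacobian] acts on row vectors by right multiplication; the
   usual matrix, whose (i, j) entry is the derivative of the i-th component
   along the j-th variable, is its transpose. *)
Definition decimated_jacobian (p : nat) x : 'M[R[i]]_data_dim :=
  (jacobian (decimated_map p) x)^T.

Definition decimated_cond (p : nat) x (alpha : 'I_data_dim) : R :=
  \sum_(i < data_dim) normc (invmx (decimated_jacobian p x) alpha i) *
    normc (decimated_map p x 0 i).

(* Angular distances lie in [0, pi], so pi and 0 are neutral for the minima
   and the maximum below, which range over nonempty sets when K >= 2. *)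
Definition eta_at x (j : 'I_K) : R :=
  \big[Num.min/pi]_(r < K | r != j) angdist (node x r) (node x j).

Definition eta x : R := \big[Num.min/pi]_(j < K) eta_at x j.

Definition eta_star x : R :=
  \big[Num.max/0]_(j < K) \big[Num.max/0]_(r < K | r != j)
    angdist (node x j) (node x r).

End Prony.

(* Main.v *)
Require Import Defs.
From mathcomp Require Import all_boot all_order all_algebra.
From mathcomp Require Import complex.
From mathcomp Require Import all_classical all_reals all_analysis.
From mathcomp Require Import ring lra zify.
Import Order.TTheory GRing.Theory Num.Theory.
Import numFieldNormedType.Exports.
Import Normc.

(** Write n for the dimension of the data space, w_j = z_j ^ p for the decimated
    nodes, and b_{l,j} = a_{l,j} p ^ l.  The k-th component of the forward map is
    sum_j w_j^k sum_l b_{l,j} k^l, so the columns of its Jacobian are combinations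
    of the vectors (k^m w_j^k)_k with m <= ell_j.  A row vector c pairs with such
    a vector to give sum_k c_k k^m w_j^k, that is, the value at w_j of theta^m c,
    where c is read as a polynomial of degree < n and theta = X d/dX.  Inverting
    the Jacobian is therefore Hermite interpolation at the nodes w_j
    ([decimated_jacobian_inverse_bound]): up to the triangular change of variables
    between amplitudes and columns, the rows of the inverse are the coefficients
    of the dual polynomials c_{j,l}, for which (theta^m c_{j,l})(w_i) is 1 if
    (i, m) = (j, l) and 0 otherwise.

    The dual polynomials at a node w are bounded in [dual_polynomial].  If every
    other node is at distance at least d from w, take the product of the factors
    (X - u) / (w - u) over the other nodes u with multiplicity, times
    (X - w)^l / (l! w^l).  It has the right moments up to order l, its moment of
    order m is O(d^(l-m)), and its coefficients are O(d^-(number of factors)).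
    Eliminating the moments of order > l one at a time preserves the estimate
    coefficients = O(d^-(n-1-l)), with a constant depending only on n.

    The hypothesis N eta^* < pi n makes decimation by p = floor(N/n) multiply all
    angular distances by p without wrapping around the circle, and since
    sin t >= t/2 on [0, pi/2] one may take d = p eta^(j) / 2
    ([decimated_separation]).  The amplitude row (j, l) of the inverse is then
    O(p^-l (p eta)^-(n-1-l)) = O(p^-(n-1) eta^-(n-1-l)), plus the analogous term
    of order ell_j with the factor a_{l-1,j} / a_{ell_j-1,j}, while the data are
    O(p^(max ell - 1)) ([decimated_map_le]).  As p is comparable to N, this is
    stronger than the claimed bound by the factor N eta, and N eta <= pi n
    absorbs it ([decimation_scaling]). *)

Local Open Scope ring_scope.
Local Open Scope complex_scope.

Set Implicit Arguments.
Unset Strict Implicit.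
Unset Printing Implicit Defensive.

(** * Moments of a polynomial at a point *)

Section Moments.
Context {F : fieldType}.
Implicit Types (f g : {poly F}) (w u v : F) (s : seq F) (m n l : nat).

(** The value at [w] of the [m]-th iterate of the derivation X d/dX on [f].
    Spelled out on coefficients, it is the pairing of the row of coefficients of
    [f] with a column of a confluent Vandermonde matrix. *)
Definition moment m w f : F := \sum_(k < size f) f`_k * k%:R ^+ m * w ^+ k.

Lemma moment_widen n m w f : (size f <= n)%N ->
  moment m w f = \sum_(k < n) f`_k * k%:R ^+ m * w ^+ k.
Proof.
move=> fn; rewrite /moment (big_ord_widen n (fun k => f`_k * k%:R ^+ m * w ^+ k)) //.
rewrite big_mkcond; apply: eq_bigr => k _; case: ltnP => // fk.
by rewrite nth_default // !mul0r.
Qed.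

Lemma moment_linear m w a f g :
  moment m w (a *: f + g) = a * moment m w f + moment m w g.
Proof.
pose n := maxn (size f) (size g).
have fn : (size f <= n)%N by rewrite leq_maxl.
have gn : (size g <= n)%N by rewrite leq_maxr.
rewrite (moment_widen _ _ fn) (moment_widen _ _ gn) (@moment_widen n).
  rewrite mulr_sumr -big_split; apply: eq_bigr => k _ /=.
  by rewrite coefD coefZ; ring.
by rewrite (leq_trans (size_polyD _ _)) // geq_max gn andbT (leq_trans (size_scale_leq _ _)).
Qed.

Lemma moment0 m w : moment m w 0 = 0.
Proof. by rewrite /moment size_poly0 big_ord0. Qed.

Lemma momentZ m w a f : moment m w (a *: f) = a * moment m w f.
Proof. by rewrite -[_ *: _]addr0 moment_linear moment0 addr0. Qed.

Lemma moment1 m w : moment m w 1 = (m == 0)%:R.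
Proof. by rewrite /moment size_poly1 big_ord1 coef1 mul1r mulr1 expr0n. Qed.

(** The binomial expansion of (k + 1)^m, applied to the shift of coefficients. *)
Lemma moment_mulX m w f :
  moment m w ('X * f) = w * \sum_(i < m.+1) 'C(m, i)%:R * moment i w f.
Proof.
have Xf : (size ('X * f)%R <= (size f).+1)%N.
  by rewrite mulrC (leq_trans (size_polyMleq _ _)) // size_polyX addn2.
rewrite (moment_widen _ _ Xf) big_ord_recl coefXM mul0r mul0r add0r.
under [X in w * X]eq_bigr => i _ do rewrite /moment mulr_sumr.
rewrite exchange_big mulr_sumr; apply: eq_bigr => k _.
rewrite coefXM !lift0 -pred_Sn exprS -natr1 addrC exprDn mulr_sumr mulr_suml mulr_sumr.
apply: eq_bigr => i _; rewrite expr1n mul1r -mulr_natl; ring.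
Qed.

(** The only Leibniz rule needed: every polynomial below is built by multiplying
    by linear factors.  The factor shows up through its value [w - u] alone, apart
    from moments of order strictly less than [m]; all estimates rest on this. *)
Lemma moment_mulXsub m w u f :
  moment m w (('X - u%:P) * f) =
  (w - u) * moment m w f + w * \sum_(i < m) 'C(m, i)%:R * moment i w f.
Proof.
rewrite mulrBl addrC -scaleN1r mul_polyC scalerA moment_linear moment_mulX.
by rewrite big_ord_recr /= binn; ring.
Qed.

(** For nonzero [w] in characteristic 0, this says that [w] is a root of [f] of
    multiplicity at least [n]. *)
Definition flat n w f := forall m, (m < n)%N -> moment m w f = 0.

Lemma flatZ n w a f : flat n w f -> flat n w (a *: f).
Proof. by move=> h m /h; rewrite momentZ => ->; rewrite mulr0. Qed.

Lemma flat_sum0 n m w f : flat n w f -> (m <= n)%N ->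
  \sum_(i < m) 'C(m, i)%:R * moment i w f = 0.
Proof. by move=> h mn; rewrite big1 // => i _; rewrite h ?mulr0 // (leq_trans _ mn). Qed.

Lemma flat_mulXsub n w u f : flat n w f -> flat n w (('X - u%:P) * f).
Proof.
move=> h m mn; rewrite moment_mulXsub h // (@flat_sum0 n) //; last exact: ltnW.
by rewrite !mulr0 addr0.
Qed.

Lemma flat_root n w f : flat n w f -> flat n.+1 w (('X - w%:P) * f).
Proof.
move=> h m mn; rewrite moment_mulXsub subrr mul0r add0r (@flat_sum0 n) ?mulr0 //.
Qed.

Lemma moment_flat_mulXsub n w u f : flat n w f ->
  moment n w (('X - u%:P) * f) = (w - u) * moment n w f.
Proof. by move=> h; rewrite moment_mulXsub (@flat_sum0 n) // mulr0 addr0. Qed.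

(** At a root of order [n] only the top term of the Leibniz rule survives; the
    factor [n.+1 * w] is what [taylor_basis] divides by. *)
Lemma moment_flat_root n w f : flat n w f ->
  moment n.+1 w (('X - w%:P) * f) = n.+1%:R * w * moment n w f.
Proof.
move=> h; rewrite moment_mulXsub subrr mul0r add0r big_ord_recr /= binSn.
have -> : \sum_(i < n) 'C(n.+1, i)%:R * moment i w f = 0.
  by apply: big1 => i _; rewrite h ?mulr0.
by rewrite add0r; ring.
Qed.

(** Product of the interpolation factors (X - u) / (w - u), equal to 1 at [w] and
    vanishing on [s] with multiplicity. *)
Fixpoint cofactor w s : {poly F} :=
  if s is u :: s' then (w - u)^-1 *: (('X - u%:P) * cofactor w s') else 1.

(** [(X - w)^l / (l! w^l)] times the cofactor, built one factor at a time so that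
    its leading moment at [w] is kept equal to 1. *)
Fixpoint taylor_basis w s l : {poly F} :=
  if l is l'.+1 then (l%:R * w)^-1 *: (('X - w%:P) * taylor_basis w s l')
  else cofactor w s.

Lemma size_mulXsub_leq u f n : (size f <= n)%N -> (size (('X - u%:P)%R * f)%R <= n.+1)%N.
Proof.
by move=> fn; rewrite (leq_trans (size_polyMleq _ _)) // size_XsubC.
Qed.

Lemma size_taylor_basis w s l : (size (taylor_basis w s l) <= (size s + l).+1)%N.
Proof.
elim: l => [|l ih] /=.
  rewrite addn0; elim: s => [|u s ih] /=; first by rewrite size_poly1.
  by rewrite (leq_trans (size_scale_leq _ _)) // size_mulXsub_leq.
by rewrite (leq_trans (size_scale_leq _ _)) // addnS size_mulXsub_leq.
Qed.

Lemma flat_taylor_basis v w s l : flat (count_mem v s) v (taylor_basis w s l).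
Proof.
elim: l => [|l ih] /=; last by apply/flatZ/flat_mulXsub.
elim: s => [|u s ih] //=; apply: flatZ.
by case: eqP => [->|_]; [exact: flat_root | exact: flat_mulXsub].
Qed.

Arguments flat_taylor_basis : clear implicits.

Lemma flat_taylor_basis_center w s l : flat l w (taylor_basis w s l).
Proof. by elim: l => [|l ih] //=; apply/flatZ/flat_root. Qed.

Arguments flat_taylor_basis_center : clear implicits.

Lemma moment_taylor_basis_center w s l : [pchar F] =i pred0 -> w != 0 -> w \notin s ->
  moment l w (taylor_basis w s l) = 1.
Proof.
move=> charF w0 ws; elim: l => [|l ih] /=.
  elim: s ws => [|u s ih] /=; first by rewrite moment1.
  rewrite inE negb_or => /andP[wu /ih e].
  by rewrite momentZ moment_flat_mulXsub // e mulr1 mulVf // subr_eq0.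
rewrite momentZ (moment_flat_root (flat_taylor_basis_center _ _ _)) ih mulr1 mulVf //.
by rewrite mulf_neq0 // ((pcharf0P F).1 charF).
Qed.

End Moments.

Arguments flat_taylor_basis {F}.
Arguments flat_taylor_basis_center {F}.

(** * Dual polynomials and their size *)

Section Bounds.
Context {R : realType}.
Implicit Types (f g : {poly R[i]}) (w u v z : R[i]) (s : seq R[i]) (d B : R) (m n l : nat).

Lemma normc_ge0 z : 0 <= normc z.
Proof. by case: z => a b /=; exact: sqrtr_ge0. Qed.

Lemma ler_normcD u v : normc (u + v) <= normc u + normc v.
Proof. exact: le_normcD. Qed.

Lemma normcN z : normc (- z) = normc z.
Proof. exact: complex.normcN. Qed.

Lemma normcX z n : normc (z ^+ n) = normc z ^+ n.
Proof. by elim: n => [|n ih]; rewrite ?expr0 ?normc1 // !exprS normcM ih. Qed.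

Lemma normc_nat n : normc (n%:R : R[i]) = n%:R.
Proof. by rewrite (complex.normcMn (1 : R[i])) normc1. Qed.

Lemma ler_normc_sum (I : Type) (r : seq I) (P : pred I) (G : I -> R[i]) :
  normc (\sum_(i <- r | P i) G i) <= \sum_(i <- r | P i) normc (G i).
Proof.
elim/big_ind2: _ => [|x1 x2 y1 y2 h1 h2|//]; first by rewrite normc0.
by rewrite (le_trans (ler_normcD _ _)) // lerD.
Qed.

Lemma normc_gt0 z : z != 0 -> 0 < normc z.
Proof. by move=> z0; rewrite lt_neqAle normc_ge0 andbT eq_sym;
  apply: contra_neq z0 => /eq0_normc. Qed.

Definition coef_bounded B f := forall k, normc f`_k <= B.

Lemma coef_boundedZ z B f : coef_bounded B f -> coef_bounded (normc z * B) (z *: f).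
Proof. by move=> h k; rewrite coefZ normcM ler_wpM2l ?normc_ge0. Qed.

Lemma coef_bounded_mulXsub u B f : normc u = 1 ->
  coef_bounded B f -> coef_bounded (2 * B) (('X - u%:P) * f).
Proof.
move=> u1 h k; rewrite mulrBl coefB coefXM coefCM.
rewrite (le_trans (ler_normcD _ _)) // normcN normcM u1 mul1r mulr_natl mulr2n lerD //.
by case: ifP => // _; rewrite normc0 (le_trans (normc_ge0 f`_0)).
Qed.

(** The moments up to order [M] are those of a function of the scale [d]
    that vanishes to order [q] at [w]: the moment of order [m] is at most
    [B * d ^ (q - m)].  The power [d ^ m] is kept on the left so that no exponent
    is negative. *)
Definition moments_bounded M d B q w f := forall m, (m <= M)%N ->
  normc (moment m w f) * d ^+ m <= B * d ^+ q.

(** Each moment of order i < m is multiplied by d^m = d^i * d * d^(m-i-1), which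
    gains one power of [d]; the other powers of [d], at most 2^M, and the sum of
    the binomial coefficients, at most 2^M, make up the constant 4^M. *)
Lemma lower_moments_bounded M d B q w f m : 0 < d <= 2 ->
  moments_bounded M d B q w f -> (m <= M)%N ->
  normc (\sum_(i < m) 'C(m, i)%:R * moment i w f) * d ^+ m
    <= 4 ^+ M * B * d ^+ q.+1.
Proof.
move=> /andP[d0 d2] h mM.
have Bq : 0 <= B * d ^+ q.
  by apply: le_trans (h 0%N isT); rewrite mulr_ge0 ?normc_ge0 ?exprn_ge0 // ltW.
rewrite (le_trans (ler_wpM2r (exprn_ge0 _ (ltW d0)) (ler_normc_sum _ _ _))) //.
rewrite mulr_suml.
have st (i : 'I_m) : normc ('C(m, i)%:R * moment i w f) * d ^+ m <=
    'C(m, i)%:R * (2 ^+ M * (B * d ^+ q.+1)).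
  rewrite normcM normc_nat -mulrA ler_wpM2l //.
  have -> : d ^+ m = d ^+ i * (d * d ^+ (m - i.+1)).
    by rewrite -exprS -exprD; congr (_ ^+ _); have := ltn_ord i; lia.
  rewrite [leLHS]mulrA (le_trans (ler_wpM2r _ (h i _))) //.
  - by rewrite mulr_ge0 ?exprn_ge0 // ltW.
  - by rewrite (leq_trans (ltnW (ltn_ord i))).
  rewrite [leRHS](_ : _ = (B * d ^+ q) * (d * 2 ^+ M)); last by rewrite exprS; ring.
  rewrite ler_wpM2l // ler_wpM2l ?(ltW d0) //.
  rewrite (@le_trans _ _ (2 ^+ (m - i.+1))) ?lerXn2r ?nnegrE ?(ltW d0) //.
  by rewrite ler_weXn2l ?ler1n //; have := ltn_ord i; lia.
rewrite (le_trans (ler_sum _ (fun i _ => st i))) // -mulr_suml -natr_sum.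
rewrite mulrA [leRHS](_ : _ = (2 ^+ M * 2 ^+ M) * (B * d ^+ q.+1)); last first.
  by rewrite -exprMn -natrM; ring.
rewrite -mulrA -[leRHS]mulrA ler_wpM2r //.
  by rewrite mulr_ge0 ?exprn_ge0 // exprS mulrCA mulr_ge0 // ltW.
rewrite (@le_trans _ _ (2 ^+ m)) ?ler_weXn2l ?ler1n //.
rewrite -natrX ler_nat -[2%N]/(1 + 1)%N expnDn big_ord_recr /= (leq_trans _ (leq_addr _ _)) //.
by apply: leq_sum => i _; rewrite !exp1n !muln1.
Qed.

Lemma moments_boundedZ M d B q z w f : moments_bounded M d B q w f ->
  moments_bounded M d (normc z * B) q w (z *: f).
Proof.
by move=> h m mM; rewrite momentZ normcM -!mulrA ler_wpM2l ?normc_ge0 // h.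
Qed.

Lemma moments_bounded_root M d B q w f : 0 < d <= 2 -> normc w = 1 ->
  moments_bounded M d B q w f ->
  moments_bounded M d (4 ^+ M * B) q.+1 w (('X - w%:P) * f).
Proof.
move=> dI w1 h m mM; rewrite moment_mulXsub subrr mul0r add0r normcM w1 mul1r.
exact: lower_moments_bounded.
Qed.

(** Dividing by [w - u] costs a factor 1/d, which is the power of [d] gained on
    the lower moments: a normalised factor at another node changes the constant
    but not the order. *)
Lemma moments_bounded_mulXsub M d B q w u f : 0 < d <= 2 -> normc w = 1 ->
  d <= normc (w - u) -> moments_bounded M d B q w f ->
  moments_bounded M d ((1 + 4 ^+ M) * B) q w ((w - u)^-1 *: (('X - u%:P) * f)).
Proof.
move=> dI w1 du h m mM; have /andP[d0 _] := dI.
have wu0 : 0 < normc (w - u) by rewrite (lt_le_trans d0).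
have wu : w - u != 0 by apply: contraTneq wu0 => ->; rewrite normc0 ltxx.
rewrite momentZ moment_mulXsub mulrDr mulKf //.
rewrite (le_trans (ler_wpM2r (exprn_ge0 _ (ltW d0)) (ler_normcD _ _))) //.
rewrite mulrDl [leRHS](_ : _ = B * d ^+ q + 4 ^+ M * B * d ^+ q); last by ring.
rewrite lerD ?h // !normcM normcV w1 mul1r.
rewrite -[leLHS]mulrA ler_pdivrMl // (le_trans (lower_moments_bounded dI h mM)) //.
rewrite exprS [leLHS](_ : _ = d * (4 ^+ M * B * d ^+ q)); last by ring.
rewrite ler_wpM2r // -mulrA mulr_ge0 ?exprn_ge0 //.
by apply: le_trans (h 0%N isT); rewrite mulr_ge0 ?normc_ge0 ?exprn_ge0 // ltW.
Qed.

Lemma moments_boundedW M d B B' q w f : 0 < d -> B <= B' ->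
  moments_bounded M d B q w f -> moments_bounded M d B' q w f.
Proof.
move=> d0 BB h m mM; rewrite (le_trans (h m mM)) // ler_wpM2r // exprn_ge0 //.
exact: ltW.
Qed.

Lemma normc_natV_le1 w n : normc w = 1 -> normc ((n.+1%:R * w)^-1) <= 1.
Proof.
by move=> w1; rewrite normcV normcM w1 mulr1 normc_nat invf_le1 ?ltr0n // ler1n.
Qed.

Lemma moments_bounded_taylor_basis M d w s l : 0 < d <= 2 -> normc w = 1 ->
  (forall u, u \in s -> d <= normc (w - u)) ->
  moments_bounded M d ((1 + 4 ^+ M) ^+ (size s + l)) l w (taylor_basis w s l).
Proof.
move=> dI w1 ds; have /andP[d0 _] := dI.
elim: l => [|l ih] /=.
  rewrite addn0; elim: s ds => [|u s ih] /= ds.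
    move=> m _; rewrite moment1 !expr0 mulr1.
    by case: m => [|m]; rewrite ?expr0 ?mulr1 ?normc1 // normc0 mul0r.
  rewrite exprS; apply: moments_bounded_mulXsub => //.
    by apply: ds; rewrite inE eqxx.
  by apply: ih => v vs; apply: ds; rewrite inE vs orbT.
rewrite addnS exprS.
have B0 : 0 <= (1 + 4 ^+ M : R) ^+ (size s + l) by rewrite exprn_ge0 // addr_ge0 // exprn_ge0.
apply: moments_boundedW (moments_boundedZ _ (moments_bounded_root dI w1 ih)) => //.
rewrite mulrA ler_wpM2r // (le_trans (ler_piMl _ (normc_natV_le1 _ w1))) ?exprn_ge0 //.
by rewrite lerDr.
Qed.

Lemma coef_bounded_taylor_basis d w s l : 0 < d -> normc w = 1 ->
  (forall u, u \in s -> normc u = 1 /\ d <= normc (w - u)) ->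
  forall k, normc (taylor_basis w s l)`_k * d ^+ size s <= 2 ^+ (size s + l).
Proof.
move=> d0 w1 ds k; rewrite -ler_pdivlMr ?exprn_gt0 //; move: k.
rewrite -/(coef_bounded (2 ^+ (size s + l) / d ^+ size s) (taylor_basis w s l)).
elim: l => [|l ih] /=.
  rewrite addn0; elim: s ds => [|u s ih] /= ds k.
    by rewrite coef1 invr1 mulr1 !expr0; case: k => [|k]; rewrite ?normc1 ?normc0.
  have [u1 du] := ds u (mem_head _ _).
  have {}ih := ih (fun v vs => ds v (mem_behead (s := u :: s) vs)).
  rewrite (le_trans (coef_boundedZ _ (coef_bounded_mulXsub u1 ih) _)) // normcV.
  rewrite !exprS invfM [leRHS](_ : _ = d^-1 * (2 * (2 ^+ size s / d ^+ size s))); last by ring.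
  rewrite ler_wpM2r ?lef_pV2 ?posrE ?(lt_le_trans d0) //.
  by rewrite !mulr_ge0 ?invr_ge0 ?exprn_ge0 // ltW.
move=> k; rewrite (le_trans (coef_boundedZ _ (coef_bounded_mulXsub w1 ih) _)) //.
rewrite addnS exprS -mulrA ler_piMl ?normc_natV_le1 //.
by rewrite !mulr_ge0 ?invr_ge0 ?exprn_ge0 // ltW.
Qed.

(** Common bound, up to powers of the scale, for the coefficients and the moments
    of a [taylor_basis] element with at most [D] linear factors. *)
Definition basis_const (D : nat) : R := (1 + 4 ^+ D) ^+ D.
(** The elimination in [dual_polynomial] has at most [D] steps, each of which
    multiplies the bounds by [1 + basis_const D]. *)
Definition dual_const (D : nat) : R :=
  basis_const D * (1 + basis_const D) ^+ D.

(** Starting from the [taylor_basis] element of order [l], subtract multiples of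
    the elements of orders l+1, ..., h to kill the moments of these orders.  The
    multiple of the element of order n is a moment of size d^(l-n), and the
    coefficients of that element are of size d^-(D-n), so that each correction is
    of the size d^-(D-l) of the initial coefficients; its moments of order m are
    of size d^(l-n) d^(n-m) = d^(l-m), as before. *)
Lemma dual_polynomial d w s h l : 0 < d <= 2 -> normc w = 1 ->
  (forall u, u \in s -> normc u = 1 /\ d <= normc (w - u)) ->
  (l <= h)%N ->
  let D := (size s + h)%N in
  exists c : {poly R[i]}, [/\ (size c <= D.+1)%N,
    forall m, (m <= h)%N -> moment m w c = (m == l)%:R,
    forall v, flat (count_mem v s) v c &
    forall k, normc c`_k * d ^+ (D - l) <= dual_const D].
Proof.
move=> dI w1 ds lh D; have /andP[d0 d2] := dI.
have d0' := ltW d0.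
set Q := basis_const D.
pose e n := taylor_basis w s n.
have Q1 : 1 <= Q by rewrite exprn_ege1 // lerDl exprn_ge0.
have Q0 : 0 <= Q by rewrite (le_trans ler01).
have w0 : w != 0 by apply: contra_eqT w1 => /negPn/eqP ->; rewrite normc0 eq_sym oner_neq0.
have ws : w \notin s.
  by apply/negP => /ds[_]; rewrite subrr normc0 leNgt d0.
have e_size n : (n <= h)%N -> (size (e n) <= D.+1)%N.
  by move=> nh; rewrite (leq_trans (size_taylor_basis _ _ _)) // ltnS leq_add2l.
have e_lead n : moment n w (e n) = 1.
  by apply: moment_taylor_basis_center => //; exact: pchar_num.
have four : 2 <= 1 + 4 ^+ D :> R.
  by rewrite [2](_ : _ = 1 + 1)// lerD2l exprn_ege1 // ler1n.
have e_coef n k : (n <= h)%N -> normc (e n)`_k * d ^+ (D - n) <= Q.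
  move=> nh; have -> : (D - n = size s + (h - n))%N by rewrite addnBA.
  rewrite exprD mulrA (le_trans (ler_wpM2r (exprn_ge0 _ d0') (coef_bounded_taylor_basis _
    d0 w1 ds k))) //.
  rewrite (@le_trans _ _ (2 ^+ (size s + n) * 2 ^+ (h - n))) //.
    by rewrite ler_wpM2l ?exprn_ge0 // lerXn2r ?nnegrE.
  rewrite -exprD -addnA subnKC // -/D lerXn2r ?nnegrE //.
have e_mom n : (n <= h)%N -> moments_bounded D d Q n w (e n).
  move=> nh; apply: (moments_boundedW d0 _ (@moments_bounded_taylor_basis D d w s n dI w1 _)).
    by rewrite ler_weXn2l ?leq_add2l // (le_trans _ four) // ler1n.
  by move=> u /ds[].
(* Induction on the number j of eliminated orders.  The bound on all the moments
   must be carried along, as it controls the next multiplier. *)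
suff key j : (j + l <= h)%N -> exists c : {poly R[i]}, [/\ (size c <= D.+1)%N,
    forall m, (m <= j + l)%N -> moment m w c = (m == l)%:R,
    forall v, flat (count_mem v s) v c,
    forall k, normc c`_k * d ^+ (D - l) <= Q * (1 + Q) ^+ j &
    moments_bounded D d (Q * (1 + Q) ^+ j) l w c].
  have := key (h - l)%N; rewrite subnK // => /(_ (leqnn h))[c [h1 h2 h3 h4 _]].
  exists c; split => // k; rewrite (le_trans (h4 k)) // ler_wpM2l // ler_weXn2l ?lerDl //.
  by rewrite (leq_trans (leq_subr _ _)) // leq_addl.
elim: j => [|j ih] jh.
  exists (e l); rewrite !mulr1; split.
  - exact: e_size.
  - move=> m; rewrite add0n leq_eqVlt => /orP[/eqP ->|ml]; first by rewrite eqxx e_lead.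
    by rewrite (flat_taylor_basis_center w s) // ltn_eqF.
  - by move=> v; apply: flat_taylor_basis.
  - by move=> k; apply: e_coef.
  - exact: e_mom.
have [c [c1 c2 c3 c4 c5]] := ih (ltnW jh).
set n := (j.+1 + l)%N; pose t := moment n w c.
set P := Q * (1 + Q) ^+ j in c4 c5.
have -> : Q * (1 + Q) ^+ j.+1 = P + P * Q by rewrite exprS /P; ring.
have P0 : 0 <= P by rewrite mulr_ge0 // exprn_ge0 // addr_ge0.
have nD : (n <= D)%N by rewrite (leq_trans jh) // leq_addl.
have ln : (l <= n)%N by rewrite leq_addl.
have t_le : normc t * d ^+ (n - l) <= P.
  rewrite -(@ler_pM2r _ (d ^+ l)) ?exprn_gt0 // -mulrA -exprD subnK //.
  exact: c5.
have mom m : moment m w ((- t) *: e n + c) = - t * moment m w (e n) + moment m w c.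
  exact: moment_linear.
exists ((- t) *: e n + c); split.
- rewrite (leq_trans (size_polyD _ _)) // geq_max c1 andbT.
  by rewrite (leq_trans (size_scale_leq _ _)) // e_size.
- move=> m; rewrite leq_eqVlt mom => /orP[/eqP ->|ml].
    by rewrite e_lead mulr1 addNr; case: eqP => // en; move: en; rewrite /n; lia.
  by rewrite (flat_taylor_basis_center w s) // mulr0 add0r c2.
- by move=> v m mv; rewrite moment_linear c3 // (flat_taylor_basis _ _ _ _ _ mv) mulr0 addr0.
- move=> k; rewrite coefD coefZ.
  rewrite (le_trans (ler_wpM2r (exprn_ge0 _ d0') (ler_normcD _ _))) // mulrDl addrC.
  rewrite lerD ?c4 // normcM normcN.
  have -> : (D - l = (n - l) + (D - n))%N by lia.
  rewrite exprD mulrACA ler_pM ?e_coef ?mulr_ge0 ?normc_ge0 ?exprn_ge0 //.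
- move=> m mD; rewrite mom.
  rewrite (le_trans (ler_wpM2r (exprn_ge0 _ d0') (ler_normcD _ _))) // mulrDl addrC.
  rewrite mulrDl lerD ?c5 // normcM normcN -[leLHS]mulrA.
  rewrite (le_trans (ler_wpM2l (normc_ge0 _) (e_mom n jh m mD))) //.
  rewrite -[in leLHS](subnK ln) exprD mulrCA mulrA [leLHS](_ : _ = Q * d ^+ l * (normc t *
    d ^+ (n - l))); last by ring.
  by rewrite [leRHS](_ : _ = Q * d ^+ l * P) ?ler_wpM2l ?mulr_ge0 ?exprn_ge0 //; ring.
Qed.

End Bounds.
(** * Distances between powers of unit complex numbers *)

Section Chords.
Context {R : realType}.
Implicit Types (t a b phi : R) (z w : R[i]).

(** By the mean value theorem sin y >= y cos y, whence for y = t/2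
    sin t = 2 sin y cos y >= t (cos y)^2 = t (1 + cos t) / 2 >= t / 2. *)
Lemma sin_ge_half t : 0 <= t <= pi / 2 -> t / 2 <= sin t.
Proof.
move=> /andP[t0 tpi].
have pi0 := pi_gt0 R.
have y0 : 0 <= t / 2 by rewrite divr_ge0.
have [|c] := @MVT_segment R sin cos _ _ y0 (fun x _ => is_derive_sin x).
  exact/continuous_subspaceT/continuous_sin.
rewrite in_itv /= => /andP[c0 cy]; rewrite sin0 !subr0 => sy.
have cosle : cos (t / 2) <= cos c.
  rewrite leNgt ltr_cos ?in_itv /= -?leNgt //; lra.
have cos0 : 0 <= cos (t / 2) by apply: cos_ge0_pihalf; lra.
have cost : 0 <= cos t by apply: cos_ge0_pihalf; lra.
have := sin_mulr2n (t / 2); have := cos_mulr2n (t / 2).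
rewrite (_ : t / 2 *+ 2 = t); last by rewrite -mulr_natr divfK.
rewrite sy => ct ->; move: cost; rewrite ct subr_ge0 -mulr_natr => C1.
rewrite -[leLHS]mul1r (le_trans (ler_wpM2r y0 C1)) //.
rewrite -[leRHS]mulr_natr expr2 mulrAC ler_wpM2r // -mulrA ler_wpM2l //.
by rewrite ler_wpM2r.
Qed.

Definition cis t : R[i] := cos t +i* sin t.

Lemma cisX t n : cis t ^+ n = cis (n%:R * t).
Proof.
elim: n => [|n ih]; first by rewrite expr0 mul0r /cis cos0 sin0.
rewrite exprS ih /cis -natr1 mulrDl mul1r addrC cosD sinD.
by simpc; congr (_ +i* _); ring.
Qed.

(** The chord of an arc of angle [phi] has length 2 sin (phi / 2). *)
Lemma chord_ge_half a b phi : 0 <= phi <= pi -> cos phi = cos (a - b) ->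
  phi / 2 <= normc (cis a - cis b).
Proof.
move=> /andP[p0 ppi] e.
have h : phi / 2 / 2 <= sin (phi / 2) by apply: sin_ge_half; lra.
rewrite /cis; simpc; rewrite /normc.
have -> : (cos a - cos b) ^+ 2 + (sin a - sin b) ^+ 2 = (2 * sin (phi / 2)) ^+ 2.
  rewrite exprMn sin2cos2.
  have := cos_mulr2n (phi / 2); rewrite (_ : phi / 2 *+ 2 = phi); last by rewrite -mulr_natr divfK.
  rewrite e cosB -mulr_natr => ec.
  have := cos2Dsin2 a; have := cos2Dsin2 b; move: ec; rewrite !expr2; lra.
rewrite sqrtr_sqr ger0_norm; lra.
Qed.

Lemma angdist_ge0 z w : normc z = 1 -> normc w = 1 -> 0 <= angdist z w.
Proof.
move=> /carg_itv/andP[a1 a2] /carg_itv/andP[b1 b2].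
rewrite /angdist le_min normr_ge0 subr_ge0 ler_norml; lra.
Qed.

(** Reducing an angular difference modulo 2 pi and up to sign does not change the
    cosine of its integer multiples. *)
Lemma cos_nat_angdist p z w : cos (p%:R * angdist z w) = cos (p%:R * carg z - p%:R * carg w).
Proof.
rewrite -mulrBr -[RHS]cos_norm normrM (ger0_norm (ler0n _ _)) /angdist.
case: leP => // _.
have -> : p%:R * (2 * pi - `|carg z - carg w|) =
          - (p%:R * `|carg z - carg w|) + (pi *+ 2) *+ p :> R.
  by rewrite mulrBr !mulr_natl addrC.
by rewrite (periodicn (@cosD2pi R)) cosN.
Qed.

Lemma power_chord_ge p z w : normc z = 1 -> normc w = 1 -> p%:R * angdist z w <= pi ->
  p%:R * angdist z w / 2 <= normc (z ^+ p - w ^+ p).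
Proof.
move=> z1 w1 h; rewrite -{2}(cargK z1) -{2}(cargK w1) -!/(cis _) !cisX.
apply: chord_ge_half; last exact: cos_nat_angdist.
by rewrite h mulr_ge0 ?ler0n ?angdist_ge0.
Qed.

End Chords.
(** * The block structure of the coordinates *)

Section Coordinates.
Variables (K : nat) (ell : 'I_K -> nat).
Implicit Types (i j : 'I_K) (l m : nat).

Lemma offset_lt i j : (i < j)%N -> (offset ell i + (ell i).+1 <= offset ell j)%N.
Proof.
move=> ij; rewrite /offset [leqRHS](bigID (fun m : 'I_K => (m < i)%N)) /=.
rewrite [X in (_ <= X + _)%N](eq_bigl (fun m : 'I_K => (m < i)%N)) => [|m]; last first.
  by case: (ltnP m i) => mi; rewrite ?andbF // andbT (ltn_trans mi).
by rewrite leq_add2l (bigD1 i) /= ?ij ?ltnn // leq_addr.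
Qed.

Lemma data_coord_inj i j l m : (l <= ell i)%N -> (m <= ell j)%N ->
  (data_coord ell i l == data_coord ell j m) = (i == j) && (l == m).
Proof.
move=> li mj; rewrite -val_eqE /= !inordK //.
have [->|ij] := eqVneq i j; first by rewrite eqn_add2l.
apply/negbTE; have [lt|gt|e] := ltngtP i j.
- by have := offset_lt lt; lia.
- by have := offset_lt gt; lia.
- by rewrite (val_inj e) eqxx in ij.
Qed.

(** An injection between finite sets of equal cardinality is onto. *)
Lemma data_coord_surj (alpha : 'I_(data_dim ell)) :
  exists i l, (l <= ell i)%N /\ alpha = data_coord ell i l.
Proof.
pose f (u : {i : 'I_K & 'I_(ell i).+1}) := data_coord ell (tag u) (tagged u).
have f_inj : injective f.
  move=> [i l] [j m] /eqP.
  rewrite /f /= (data_coord_inj (i := i) (l := l)) ?(leq_ord l) ?(leq_ord m) // => /andP[/eqP e].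
  by case: _ / e m => m /eqP/val_inj ->.
have card_le : (#|'I_(data_dim ell)| <= #|{: {i : 'I_K & 'I_(ell i).+1}}|)%N.
  rewrite card_tagged sumnE big_map big_enum /= card_ord /data_dim.
  rewrite [leqRHS](eq_bigr (fun i => ell i + 1)%N) => [|i _].
    by rewrite big_split /= sum1_card card_ord.
  by rewrite card_ord addn1.
have /codomP[[i l] ->] := inj_card_onto f_inj card_le alpha.
by exists i, l; rewrite -ltnS.
Qed.

End Coordinates.

(** * The Jacobian of the decimated map *)

Section Differentials.
Context {F : numFieldType}.

Lemma is_diff_coord n (x : 'rV[F]_n) i :
  is_diff x (fun y : 'rV[F]_n => y 0 i : F) (fun v : 'rV[F]_n => v 0 i).
Proof.
have @f : {linear 'rV[F]_n -> F}.
  by exists (fun y : 'rV[F]_n => y 0 i); do 2![eexists]; do ?[constructor];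
     rewrite ?mxE// => ? *; rewrite ?mxE//; move=> ?; rewrite !mxE.
split; first exact: differentiable_coord.
have e : (fun v : 'rV[F]_n => v 0 i) = f by [].
by rewrite e diff_lin //; exact: coord_continuous.
Qed.

Lemma is_diff_sum (V W : normedModType F) (I : Type) (r : seq I)
    (f df : I -> V -> W) (x : V) :
  (forall i, is_diff x (f i) (df i)) ->
  is_diff x (fun y => \sum_(i <- r) f i y) (fun v => \sum_(i <- r) df i v).
Proof.
move=> h.
have e (g : I -> V -> W) : (fun y => \sum_(i <- r) g i y) = \sum_(i <- r) g i.
  by apply/funext => y; rewrite fct_sumE.
rewrite !e; elim/big_rec2: _ => [|i df' f' _ ih]; first exact: is_diff_cst.
exact: is_diffD.
Qed.

Lemma is_diff_power (V : normedModType F) (f df : V -> F) n (x : V) :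
  is_diff x f df ->
  is_diff x (fun y => f y ^+ n) (fun v => n%:R * f x ^+ n.-1 * df v).
Proof.
move=> h; case: n => [|n].
  apply: (is_diff_eq (is_diff_cst (1 : F) x)).
  by apply/funext => v /=; rewrite !mul0r.
rewrite (_ : (fun y => _) = f ^+ n.+1); last by apply/funext => y; rewrite exprfctE.
exact: is_diffX.
Qed.

Lemma is_diff_row n (V : normedModType F) (f df : 'I_n -> V -> F) (x : V) :
  (forall i, is_diff x (f i) (df i)) ->
  is_diff x (fun y => \row_i f i y) (fun v => \row_i df i v).
Proof.
move=> h.
have e (g : 'I_n -> V -> F) : (fun y => \row_i g i y) =
    fun y => \sum_i (fun y => g i y *: delta_mx 0 i : 'rV[F]_n) y.
  apply/funext => y; rewrite [LHS]row_sum_delta.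
  by apply: eq_bigr => i _; rewrite mxE.
rewrite !e; apply: is_diff_sum => i.
have dfi : differentiable (f i) x by exact: ex_diff.
split; first exact: differentiableZl.
rewrite diffZl //; apply/funext => v.
by rewrite (@diff_val _ _ _ _ _ _ _ (h i)).
Qed.

(** Stated over an arbitrary field with a norm, and with arbitrary positions [nd]
    and [am] of the nodes and amplitudes; [.-1] is harmless at the component k = 0
    because of the factor [p * k]. *)
Lemma jacobian_exponential_sum n K (ell : 'I_K -> nat) (nd : 'I_K -> 'I_n)
    (am : 'I_K -> nat -> 'I_n) p (x : 'rV[F]_n) (beta k : 'I_n) :
  jacobian (fun y : 'rV[F]_n => \row_(k < n) \sum_(j < K) y 0 (nd j) ^+ (p * k) *
      \sum_(l < ell j) (y 0 (am j l) * p%:R ^+ l) * k%:R ^+ l) x beta k =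
  \sum_(j < K) ((p * k)%:R * x 0 (nd j) ^+ (p * k).-1 * (beta == nd j)%:R *
                 (\sum_(l < ell j) (x 0 (am j l) * p%:R ^+ l) * k%:R ^+ l) +
               x 0 (nd j) ^+ (p * k) *
                 \sum_(l < ell j) ((beta == am j l)%:R * p%:R ^+ l) * k%:R ^+ l).
Proof.
pose dF (k : 'I_n) (v : 'rV[F]_n) : F := \sum_(j < K)
   ((p * k)%:R * x 0 (nd j) ^+ (p * k).-1 * v 0 (nd j) *
      (\sum_(l < ell j) (x 0 (am j l) * p%:R ^+ l) * k%:R ^+ l) +
    x 0 (nd j) ^+ (p * k) * \sum_(l < ell j) (v 0 (am j l) * p%:R ^+ l) * k%:R ^+ l).
set G := (fun y => _).
have D : is_diff x G (fun v => \row_k dF k v).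
  apply: is_diff_row => {}k; apply: is_diff_sum => j.
  have d1 := is_diff_power (p * k) (is_diff_coord x (nd j)).
  have d2 : is_diff x (fun y : 'rV[F]_n => \sum_(l < ell j) (y 0 (am j l) * p%:R ^+ l) *
    k%:R ^+ l : F)
      (fun v => \sum_(l < ell j) (v 0 (am j l) * p%:R ^+ l) * k%:R ^+ l).
    apply: is_diff_sum => l.
    have e : (fun y : 'rV[F]_n => y 0 (am j l) * p%:R ^+ l * k%:R ^+ l) =
             (p%:R ^+ l * k%:R ^+ l : F) *: (fun y : 'rV[F]_n => y 0 (am j l) : F).
      by apply/funext => y; rewrite /= -mulrA mulrC.
    by rewrite !e; apply: is_diffZ; apply: is_diff_coord.
  apply: (is_diff_eq (is_diffM d1 d2)).
  apply/funext => v; rewrite /= [LHS]addrC.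
  by congr (_ + _); exact: mulrC.
rewrite /jacobian mxE.
have -> : ('d G x : _ -> _) = (fun v => \row_k dF k v) by exact: diff_val.
rewrite mxE; apply: eq_bigr => j _; rewrite mxE eqxx /= [_ == beta]eq_sym.
congr (_ + _ * _); apply: eq_bigr => l _; rewrite mxE eqxx /= [_ == beta]eq_sym.
by [].
Qed.

End Differentials.

Section Jacobian.
Variables (R : realType) (K : nat) (ell : 'I_K -> nat).
Notation dim := (data_dim ell).
Implicit Types (x v : 'rV[R[i]]_dim) (p m : nat) (i j : 'I_K).

Lemma decimated_jacobianE p x (k beta : 'I_dim) :
  decimated_jacobian p x k beta =
  \sum_(j < K) ((p * k)%:R * node x j ^+ (p * k).-1 * (beta == data_coord ell j (ell j))%:R *
                 (\sum_(l < ell j) (amp x j l * p%:R ^+ l) * k%:R ^+ l) +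
               node x j ^+ (p * k) *
                 \sum_(l < ell j) ((beta == data_coord ell j l)%:R * p%:R ^+ l) * k%:R ^+ l).
Proof.
rewrite /decimated_jacobian mxE.
exact: (@jacobian_exponential_sum _ _ _ ell (fun j => data_coord ell j (ell j))
          (data_coord ell)).
Qed.

Lemma jacobian_amp p x (k : 'I_dim) i m : (m < ell i)%N ->
  decimated_jacobian p x k (data_coord ell i m) =
  p%:R ^+ m * (k%:R ^+ m * (node x i ^+ p) ^+ k).
Proof.
move=> mi; rewrite decimated_jacobianE (bigD1 i) //= [X in _ + X]big1 => [|j ji].
  rewrite data_coord_inj ?(ltnW mi) // eqxx /= (ltn_eqF mi) mulr0 mul0r add0r addr0.
  rewrite (bigD1 (Ordinal mi)) //= big1 => [|l lm].
    by rewrite eqxx mul1r addr0 exprM; ring.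
  rewrite data_coord_inj ?(ltnW mi) ?(ltnW (ltn_ord l)) // eqxx /=.
  by rewrite -val_eqE eq_sym /= in lm; rewrite (negbTE lm) !mul0r.
rewrite data_coord_inj ?(ltnW mi) // eq_sym (negbTE ji) /= mulr0 mul0r add0r.
rewrite big1 ?mulr0 // => l _.
by rewrite data_coord_inj ?(ltnW mi) ?(ltnW (ltn_ord l)) // eq_sym (negbTE ji) !mul0r.
Qed.

Lemma jacobian_node p x (k : 'I_dim) i : node x i != 0 ->
  decimated_jacobian p x k (data_coord ell i (ell i)) =
  (node x i)^-1 * \sum_(l < ell i) amp x i l * p%:R ^+ l.+1 *
                    (k%:R ^+ l.+1 * (node x i ^+ p) ^+ k).
Proof.
move=> z0; rewrite decimated_jacobianE (bigD1 i) //= [X in _ + X]big1 => [|j ji].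
  rewrite eqxx mulr1 [X in _ + _ * X]big1 => [|l _]; last first.
    by rewrite data_coord_inj ?(ltnW (ltn_ord l)) // gtn_eqF ?ltn_ord // andbF !mul0r.
  rewrite mulr0 !addr0.
  have -> : (p * k)%:R * node x i ^+ (p * k).-1 =
      (node x i)^-1 * (p%:R * (k%:R * (node x i ^+ p) ^+ k)).
    rewrite -exprM natrM; case: (p * k)%N (natrM R[i] p k) => [|n] e.
      by rewrite (mulrA p%:R) -e !mul0r mulr0.
    by rewrite exprS /=; field.
  rewrite -mulrA; congr (_ * _); rewrite mulr_sumr; apply: eq_bigr => l _.
  by rewrite !exprS; ring.
rewrite data_coord_inj // eq_sym (negbTE ji) /= mulr0 mul0r add0r.
rewrite big1 ?mulr0 // => l _.
by rewrite data_coord_inj ?(ltnW (ltn_ord l)) // eq_sym (negbTE ji) !mul0r.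
Qed.

End Jacobian.
(** * The inverse of the Jacobian *)

Section DualRows.
Variables (R : realType) (K : nat) (ell : 'I_K -> nat).
Notation dim := (data_dim ell).
Implicit Types (p m : nat) (i j : 'I_K) (q c : {poly R[i]}).

Lemma data_dim_split j : dim = ((\sum_(i < K | i != j) (ell i).+1 + ell j).+1)%N.
Proof.
rewrite /data_dim -[X in (_ + X)%N]card_ord -sum1_card -big_split /= (bigD1 j) //=.
rewrite addn1 addSn addnC; congr (_ + _).+1.
by apply: eq_bigr => i _; rewrite addn1.
Qed.

(** Hermite interpolation at all the nodes: [dual_polynomial] for the list of the
    nodes other than [w j], each repeated [(ell i).+1] times. *)
Lemma dual_node_polynomial (w : 'I_K -> R[i]) (d : R) j l :
  (forall i, normc (w i) = 1) -> 0 < d <= 2 ->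
  (forall i, i != j -> d <= normc (w j - w i)) -> (l <= ell j)%N ->
  exists c, [/\ (size c <= dim)%N,
    forall i m, (m <= ell i)%N -> moment m (w i) c = ((i == j) && (m == l))%:R &
    forall k, normc c`_k * d ^+ (dim.-1 - l) <= dual_const dim.-1].
Proof.
move=> w1 dI dw lj.
pose s := flatten [seq nseq (ell i).+1 (w i) | i <- enum 'I_K & i != j].
have s_size : (size s + ell j)%N = dim.-1.
  rewrite (data_dim_split j) /=; congr (_ + _)%N.
  rewrite /s size_flatten /shape -map_comp sumnE big_map big_filter big_enum_cond /=.
  by apply: eq_bigr => i _; rewrite size_nseq.
have s_mem u : u \in s -> normc u = 1 /\ d <= normc (w j - u).
  move=> /flatten_mapP[r]; rewrite mem_filter => /andP[rj _].
  by rewrite mem_nseq => /eqP ->; split; [exact: w1 | exact: dw].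
have [c []] := dual_polynomial dI (w1 j) s_mem lj.
rewrite s_size => c1 c2 c3 c4; exists c; split => //.
  by rewrite (data_dim_split j) in c1 *.
move=> i m mi; have [e|ij] /= := eqVneq i j.
  by rewrite e c2 // -e.
apply: c3; apply: (@leq_trans (ell i).+1) => //.
rewrite /s count_flatten -map_comp sumnE big_map big_filter big_enum_cond /=.
by rewrite (bigD1 i) //= count_nseq /= eqxx mul1n leq_addr.
Qed.

Variables (x : 'rV[R[i]]_dim) (p : nat).
Hypothesis node1 : forall j, normc (node x j) = 1.
Hypothesis top0 : forall j, amp_top x j != 0.
Hypothesis ell0 : forall j, (0 < ell j)%N.
Hypothesis p0 : (0 < p)%N.

Let J := decimated_jacobian p x.
Let w j := node x j ^+ p.

Let node0 j : node x j != 0.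
Proof. by apply: contra_eqT (node1 j) => /negPn/eqP ->; rewrite normc0 eq_sym oner_neq0. Qed.

Let p_neq0 : (p%:R : R[i]) != 0.
Proof. by rewrite pnatr_eq0 -lt0n. Qed.

Let coef_row q : 'rV[R[i]]_dim := \row_k q`_k.

Lemma coef_row_amp q i m : (size q <= dim)%N -> (m < ell i)%N ->
  (coef_row q *m J) 0 (data_coord ell i m) = p%:R ^+ m * moment m (w i) q.
Proof.
move=> qn mi; rewrite mxE (moment_widen _ _ qn) mulr_sumr; apply: eq_bigr => k _.
by rewrite mxE jacobian_amp // /w; ring.
Qed.

Lemma coef_row_node q i : (size q <= dim)%N ->
  (coef_row q *m J) 0 (data_coord ell i (ell i)) =
  (node x i)^-1 * \sum_(l < ell i) amp x i l * p%:R ^+ l.+1 * moment l.+1 (w i) q.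
Proof.
move=> qn; rewrite mxE.
under [in RHS]eq_bigr => l _ do rewrite (moment_widen _ _ qn) mulr_sumr.
rewrite exchange_big mulr_sumr; apply: eq_bigr => k _.
rewrite mxE jacobian_node // mulrCA mulr_sumr; congr (_ * _).
by apply: eq_bigr => l _; rewrite /w; ring.
Qed.

Lemma amp_prev_top j : amp_prev x j (ell j) = amp_top x j.
Proof. by rewrite /amp_prev /amp_top; case: (ell j) (ell0 j). Qed.

(** The node column of block [i] is a combination of the columns of orders
    1, ..., ell i with the amplitudes of orders 0, ..., ell i - 1 as coefficients;
    the dual polynomial of order [l] picks the amplitude of order l - 1. *)
Lemma coef_row_dual c j l : (size c <= dim)%N -> (l <= ell j)%N ->
  (forall i m, (m <= ell i)%N -> moment m (w i) c = ((i == j) && (m == l))%:R) ->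
  (forall i m, (m < ell i)%N ->
     (coef_row c *m J) 0 (data_coord ell i m) = p%:R ^+ l * ((i == j) && (m == l))%:R) /\
  (forall i, (coef_row c *m J) 0 (data_coord ell i (ell i)) =
     (i == j)%:R * (node x j)^-1 * amp_prev x j l * p%:R ^+ l).
Proof.
move=> cn lj cm; split=> [i m mi|i].
  rewrite coef_row_amp // cm 1?ltnW //.
  by case: (m =P l) => [->//|_]; rewrite andbF !mulr0.
rewrite coef_row_node //.
have [->|ij] := eqVneq i j; last first.
  rewrite big1 ?mulr0 ?mul0r // => m _.
  by rewrite cm // (negbTE ij) mulr0.
rewrite mul1r -mulrA; congr (_ * _).
under eq_bigr => m _ do rewrite cm // eqxx /=.
case: l lj {cm} => [|l] lj /=.
  by rewrite mul0r big1 // => m _; rewrite mulr0.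
rewrite (bigD1 (Ordinal lj)) //= eqxx mulr1 big1 ?addr0 // => m ml.
by rewrite -val_eqE /= in ml; rewrite eqSS (negbTE ml) mulr0.
Qed.

Lemma eq_delta_row (u : 'rV[R[i]]_dim) alpha :
  (forall i m, (m <= ell i)%N ->
     u 0 (data_coord ell i m) = (alpha == data_coord ell i m)%:R) ->
  u = delta_mx 0 alpha.
Proof.
move=> h; apply/rowP => beta; have [i [m [mi ->]]] := data_coord_surj beta.
by rewrite h // mxE eqxx /= eq_sym.
Qed.

Variable d : 'I_K -> R.
Hypothesis dI : forall j, 0 < d j <= 2.
Hypothesis dw : forall i j, i != j -> d j <= normc (w j - w i).

Let w1 j : normc (w j) = 1.
Proof. by rewrite /w normcX node1 expr1n. Qed.

Let Q : R := dual_const dim.-1.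
(* The size of the dual polynomial of order l at node j after division by p^l. *)
Let gain j l : R := (p%:R ^+ l * d j ^+ (dim.-1 - l))^-1.

Let dual_coef_le j l c k : normc c`_k * d j ^+ (dim.-1 - l) <= Q ->
  normc (c`_k / p%:R ^+ l) <= Q * gain j l.
Proof.
have /andP[dj _] := dI j => h.
rewrite normcM normcV normcX normc_nat /gain invfM [leRHS]mulrCA [leRHS]mulrC ler_wpM2r //.
by rewrite ler_pdivlMr ?exprn_gt0.
Qed.

(** Among the columns of block [j], only the node column involves the moment of
    order [ell j], with coefficient [amp_top x j * p^(ell j) / node x j]. *)
Lemma node_row j : exists u : 'rV[R[i]]_dim,
  u *m J = delta_mx 0 (data_coord ell j (ell j)) /\
  forall k, normc (u 0 k) <= Q / normc (amp_top x j) * gain j (ell j).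
Proof.
have [c [c1 c2 c3]] := dual_node_polynomial w1 (dI j) (fun i => @dw i j) (leqnn (ell j)).
have [ca cn] := coef_row_dual c1 (leqnn _) c2.
exists ((node x j / amp_top x j / p%:R ^+ ell j) *: coef_row c); split.
  rewrite -scalemxAl; apply: eq_delta_row => i m mi; rewrite mxE data_coord_inj //.
  move: mi; rewrite leq_eqVlt; case/orP => [/eqP ->|mi].
    rewrite cn amp_prev_top eq_sym; have [->|ij] := eqVneq i j; last by rewrite !mul0r mulr0.
    by rewrite eqxx /=; field; rewrite node0 top0 expf_neq0.
  rewrite ca // (eq_sym j) (eq_sym (ell j)).
  by case: (i =P j) mi => [->|_] mi; rewrite ?(ltn_eqF mi) /= !mulr0.
move=> k; rewrite !mxE.
rewrite (_ : _ * c`_k = node x j / amp_top x j * (c`_k / p%:R ^+ ell j)); last by ring.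
rewrite normcM normcM node1 mul1r normcV
  [leRHS](_ : _ = (normc (amp_top x j))^-1 * (Q * gain j (ell j))); last by ring.
by rewrite ler_wpM2l ?invr_ge0 ?normc_ge0 // dual_coef_le.
Qed.

(** The dual polynomial of order [l] pairs to 1 with its amplitude column but also
    with the node column, through the amplitude of order l - 1; a multiple of
    the dual polynomial of order [ell j] cancels the latter. *)
Lemma amp_row j l : (l < ell j)%N -> exists u : 'rV[R[i]]_dim,
  u *m J = delta_mx 0 (data_coord ell j l) /\
  forall k, normc (u 0 k) <=
    Q * (gain j l + normc (amp_prev x j l) / normc (amp_top x j) * gain j (ell j)).
Proof.
move=> lj.
have [c [c1 c2 c3]] := dual_node_polynomial w1 (dI j) (fun i => @dw i j) (ltnW lj).
have [b [b1 b2 b3]] := dual_node_polynomial w1 (dI j) (fun i => @dw i j) (leqnn (ell j)).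
have [ca cn] := coef_row_dual c1 (ltnW lj) c2.
have [ba bn] := coef_row_dual b1 (leqnn _) b2.
pose t := amp_prev x j l / amp_top x j.
exists ((p%:R ^+ l)^-1 *: coef_row c - (t / p%:R ^+ ell j) *: coef_row b); split.
  rewrite mulmxBl -!scalemxAl; apply: eq_delta_row => i m mi.
  have sub_entry a b' (u v : 'rV[R[i]]_dim) k : (a *: u - b' *: v) 0 k = a * u 0 k - b' * v 0 k.
    by rewrite !mxE.
  rewrite sub_entry data_coord_inj ?(ltnW lj) //.
  move: mi; rewrite leq_eqVlt; case/orP => [/eqP ->|mi].
    rewrite cn bn amp_prev_top (eq_sym j); have [->|ij] := eqVneq i j; last first.
      by rewrite !mul0r !mulr0 subrr.
    rewrite (ltn_eqF lj) /t /=; field.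
    by rewrite node0 top0 !expf_neq0.
  rewrite ca // ba // (eq_sym j) (eq_sym l).
  have -> : (i == j) && (m == ell j) = false.
    by case: (i =P j) mi => [->|_] mi //; rewrite (ltn_eqF mi).
  by rewrite mulr0 mulr0 subr0 mulKf // expf_neq0.
move=> k; rewrite !mxE (le_trans (ler_normcD _ _)) // normcN mulrDr lerD //.
  by rewrite mulrC dual_coef_le.
rewrite (_ : t / _ * _ = t * (b`_k / p%:R ^+ ell j)); last by ring.
rewrite normcM {1}/t normcM normcV mulrCA ler_wpM2l ?dual_coef_le //.
by rewrite mulr_ge0 ?invr_ge0 ?normc_ge0.
Qed.

Lemma decimated_jacobian_inverse_bound : J \in unitmx /\ forall j,
  (forall l k, (l < ell j)%N -> normc (invmx J (data_coord ell j l) k) <=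
    Q * (gain j l + normc (amp_prev x j l) / normc (amp_top x j) * gain j (ell j))) /\
  (forall k, normc (invmx J (data_coord ell j (ell j)) k) <=
    Q / normc (amp_top x j) * gain j (ell j)).
Proof.
have JU : J \in unitmx.
  rewrite -row_full_unit -sub1mx; apply/row_subP => alpha; rewrite row1.
  have [j [l [lj ->]]] := data_coord_surj alpha.
  move: lj; rewrite leq_eqVlt => /orP[/eqP ->|lj].
    by have [u [<- _]] := node_row j; exact: submxMl.
  by have [u [<- _]] := amp_row lj; exact: submxMl.
have inv_row (u : 'rV[R[i]]_dim) alpha k : u *m J = delta_mx 0 alpha -> invmx J alpha k = u 0 k.
  move=> /(congr1 (mulmxr (invmx J))) /=; rewrite mulmxK // -rowE => ->.
  by rewrite mxE.
split=> // j; split=> [l k lj|k].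
  by have [u [/inv_row -> ub]] := amp_row lj.
by have [u [/inv_row -> ub]] := node_row j.
Qed.

End DualRows.
(** * Trading the decimation parameter for the number of samples *)

Section Scaling.
Context {R : realType}.
Implicit Types (e : R) (n N p L l h : nat).

Lemma pi_le4 : pi <= 4 :> R.
Proof. have := @pihalf_lt2 R; lra. Qed.

Definition scaling_const n : R := 2 ^+ n * (2 * n%:R) ^+ n * (4 * n%:R).

(** With m = n - L and k = n - 1 - l, the left-hand side is
    2^k / (e^k p^m).  Then N <= 2 n p bounds 1 / p^m by (2n)^m / N^m, and
    N e <= 4 n supplies the remaining factor 1 / (N e). *)
Lemma decimation_scaling n N L l e : (n <= N)%N -> (0 < L <= n)%N -> (l < n)%N ->
  0 < e -> N%:R * e <= 4 * n%:R ->
  let p := (N %/ n)%N in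
  (p%:R ^+ l * (p%:R * e / 2) ^+ (n.-1 - l))^-1 * p%:R ^+ L.-1 <=
  scaling_const n * (1 / e) ^+ (n - l) * (1 / N%:R ^+ (n + 1 - L)).
Proof.
move=> nN /andP[L0 Ln] ln e0 Ne; set p := (N %/ n)%N => /=.
have n0 : (0 < n)%N by apply: leq_ltn_trans ln.
have p0 : (0 < p)%N by rewrite divn_gt0.
have pR : 0 < p%:R :> R by rewrite ltr0n.
have NR : 0 < N%:R :> R by rewrite ltr0n (leq_trans n0).
have Np : N%:R <= 2 * n%:R * p%:R :> R.
  rewrite -!natrM ler_nat {1}(divn_eq N n) -/p.
  by have := ltn_pmod N n0; nia.
have [k nk] : exists k, n = (l + k).+1 by exists (n.-1 - l)%N; lia.
have [m nm] : exists m, n = (m + L)%N by exists (n - L)%N; lia.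
have -> : (n.-1 - l = k)%N by lia.
have -> : (n - l = k.+1)%N by lia.
have -> : (n + 1 - L = m.+1)%N by lia.
have pX : p%:R ^+ l * (p%:R * e / 2) ^+ k = p%:R ^+ m * p%:R ^+ L.-1 * (e / 2) ^+ k.
  by rewrite -mulrA exprMn mulrA -!exprD; congr (_ ^+ _ * _); lia.
have X0 : 0 < p%:R ^+ l * (p%:R * e / 2) ^+ k.
  by rewrite mulr_gt0 ?exprn_gt0 // divr_gt0 // mulr_gt0.
rewrite [leRHS](_ : _ = scaling_const n / (e ^+ k.+1 * N%:R ^+ m.+1)); last first.
  by rewrite !div1r exprVn invfM mulrA.
rewrite mulrC ler_pdivrMr // mulrAC ler_pdivlMr; last first.
  by rewrite mulr_gt0 ?exprn_gt0.
rewrite pX [leLHS](_ : _ = (p%:R ^+ L.-1 * e ^+ k) * (N%:R ^+ m * (N%:R * e))); last first.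
  by rewrite !exprS; ring.
rewrite exprMn exprVn [leRHS](_ : _ = (p%:R ^+ L.-1 * e ^+ k) *
  (scaling_const n * p%:R ^+ m / 2 ^+ k)); last by ring.
rewrite ler_wpM2l ?mulr_ge0 ?exprn_ge0 ?(ltW e0) //.
rewrite [leRHS](_ : _ = (2 ^+ n / 2 ^+ k) * ((2 * n%:R) ^+ n * p%:R ^+ m * (4 * n%:R))); last first.
  by rewrite /scaling_const; ring.
rewrite -[leLHS]mul1r ler_pM //.
- by rewrite !mulr_ge0 ?exprn_ge0 // ltW.
- by rewrite ler_pdivlMr ?exprn_gt0 // mul1r ler_weXn2l ?ler1n //; lia.
rewrite ler_pM ?exprn_ge0 ?mulr_ge0 ?(ltW e0) //.
rewrite (@le_trans _ _ ((2 * n%:R * p%:R) ^+ m)) ?lerXn2r ?nnegrE ?mulr_ge0 //.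
rewrite exprMn ler_wpM2r ?exprn_ge0 // ler_weXn2l //; last by lia.
by rewrite -natrM ler1n; lia.
Qed.

Lemma scaling_weaken n h l e : (l <= h <= n)%N -> 0 < e <= 4 ->
  (1 / e) ^+ (n - h) <= 4 ^+ n * (1 / e) ^+ (n - l).
Proof.
move=> /andP[lh hn] /andP[e0 e4].
have -> : (n - l = (n - h) + (h - l))%N by lia.
rewrite exprD mulrCA ler_peMr ?exprn_ge0 ?divr_ge0 ?(ltW e0) //.
rewrite (@le_trans _ _ (4 ^+ (h - l) * (1 / e) ^+ (h - l))) //.
  by rewrite -exprMn exprn_ege1 // mulrA mulr1 ler_pdivlMr // mul1r.
rewrite ler_wpM2r ?exprn_ge0 ?divr_ge0 ?(ltW e0) // ler_weXn2l ?ler1n //; lia.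
Qed.

End Scaling.

(** * The size of the data *)

Section DataBound.
Variables (R : realType) (K : nat) (ell : 'I_K -> nat).
Notation dim := (data_dim ell).

Definition data_const (A : R) : R := dim%:R * (A * dim%:R ^+ dim).

Lemma ell_le_dim j : (ell j < dim)%N.
Proof. by rewrite (data_dim_split ell j) ltnS leq_addl. Qed.

Lemma decimated_map_le (x : 'rV[R[i]]_dim) p A k : 0 <= A -> (0 < p)%N ->
  (forall j, normc (node x j) = 1) ->
  (forall j l, (l < ell j)%N -> normc (amp x j l) <= A) ->
  normc (decimated_map p x 0 k) <=
    data_const A * p%:R ^+ (\max_(i < K) ell i).-1.
Proof.
move=> A0 p0 node1 ampA; set L := \max_(i < K) ell i.
pose T := A * dim%:R ^+ dim * p%:R ^+ L.-1 : R.
have T0 : 0 <= T by rewrite !mulr_ge0 ?exprn_ge0.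
have term j (l : 'I_(ell j)) : normc ((amp x j l * p%:R ^+ l) * k%:R ^+ l) <= T.
  rewrite !normcM !normcX !normc_nat mulrAC /T.
  have lL : (l <= L.-1)%N.
    by have := ltn_ord l; have := leq_bigmax j : (ell j <= L)%N; lia.
  rewrite ler_pM ?mulr_ge0 ?exprn_ge0 ?normc_ge0 ?ler_pM ?normc_ge0 ?exprn_ge0 ?ampA //.
    rewrite (@le_trans _ _ (dim%:R ^+ l)) ?lerXn2r ?nnegrE ?ler_nat ?(ltnW (ltn_ord k)) //.
    rewrite ler_weXn2l //; first by rewrite ler1n (leq_ltn_trans _ (ltn_ord k)).
    by have := ell_le_dim j; have := ltn_ord l; lia.
  by rewrite ler_weXn2l // ler1n.
rewrite mxE (le_trans (ler_normc_sum _ _ _)) //.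
rewrite (@le_trans _ _ (\sum_(j < K) (ell j)%:R * T)) //.
  apply: ler_sum => j _; rewrite normcM normcX node1 expr1n mul1r.
  rewrite (le_trans (ler_normc_sum _ _ _)) // (le_trans (ler_sum _ (fun l _ => term j l))) //.
  by rewrite sumr_const card_ord mulr_natl.
rewrite -mulr_suml -natr_sum /data_const -mulrA ler_wpM2r // ler_nat /data_dim leq_addr //.
Qed.

End DataBound.
(** * Separation of the decimated nodes *)

Lemma exists_other K (j : 'I_K) : (2 <= K)%N -> exists i, i != j.
Proof.
move=> K2; have /card_gt0P[r rj] : (0 < #|predC1 j|)%N by rewrite cardC1 card_ord; lia.
by exists r.
Qed.

Section Separation.
Variables (R : realType) (K : nat) (ell : 'I_K -> nat) (x : 'rV[R[i]]_(data_dim ell)).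
Notation dim := (data_dim ell).
Hypothesis K2 : (2 <= K)%N.
Hypothesis node1 : forall j, normc (node x j) = 1.
Hypothesis eta0 : 0 < eta x.
Variable N : nat.
Hypothesis dim0 : (0 < dim)%N.
Hypothesis no_wrap : N%:R * eta_star x < pi * dim%:R.
Let p := (N %/ dim)%N.

Lemma eta_at_gt0 j : 0 < eta_at x j.
Proof. by apply: lt_le_trans eta0 _; exact: bigmin_le. Qed.

Lemma eta_at_le4 j : eta_at x j <= 4.
Proof. by rewrite (le_trans _ (pi_le4)) // bigmin_le_id. Qed.

Lemma angdist_le_eta_star i j : i != j -> angdist (node x i) (node x j) <= eta_star x.
Proof.
move=> ij; rewrite (le_trans _ (le_bigmax 0 _ i)) //.
by apply: (le_bigmax_cond 0 (fun r => angdist (node x i) (node x r))); rewrite eq_sym.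
Qed.

Lemma eta_at_le_angdist i j : i != j -> eta_at x j <= angdist (node x i) (node x j).
Proof. by move=> ij; exact: (bigmin_le_cond _ (fun r => angdist (node x r) (node x j))). Qed.

(** Since [p * dim <= N], decimation does not wrap angles around the circle. *)
Lemma decimated_angdist_le_pi i j : i != j -> p%:R * angdist (node x i) (node x j) <= pi.
Proof.
move=> ij; have dimR : 0 < dim%:R :> R by rewrite ltr0n.
rewrite -(ler_pM2r dimR) mulrAC -natrM (le_trans _ (ltW no_wrap)) //.
rewrite ler_pM ?ler0n ?angdist_ge0 ?angdist_le_eta_star // ler_nat.
exact: leq_divM.
Qed.

Lemma no_wrap_eta_at j : N%:R * eta_at x j <= 4 * dim%:R.
Proof.
have [i ij] := exists_other j K2.
have e_le : eta_at x j <= eta_star x.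
  exact: le_trans (eta_at_le_angdist ij) (angdist_le_eta_star ij).
rewrite (le_trans (ler_wpM2l (ler0n _ _) e_le)) // (le_trans (ltW no_wrap)) //.
by rewrite ler_wpM2r // pi_le4.
Qed.

Lemma decimated_separation i j : i != j ->
  p%:R * eta_at x j / 2 <= normc (node x j ^+ p - node x i ^+ p).
Proof.
move=> ij; rewrite -normcN opprB.
apply: le_trans (power_chord_ge (node1 i) (node1 j) (decimated_angdist_le_pi ij)).
by rewrite ler_wpM2r ?invr_ge0 // ler_wpM2l // eta_at_le_angdist.
Qed.

Lemma decimated_gap_bounds j : (0 < p)%N -> 0 < p%:R * eta_at x j / 2 <= 2.
Proof.
move=> p0; rewrite divr_gt0 ?mulr_gt0 ?ltr0n ?eta_at_gt0 //=.
have [i ij] := exists_other j K2.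
have := decimated_angdist_le_pi ij; have := @pi_le4 R.
have := ler_wpM2l (ler0n R p) (eta_at_le_angdist ij); lra.
Qed.

End Separation.

(** * The condition numbers *)

Lemma decimated_cond_le (R : realType) (K : nat) (ell : 'I_K -> nat)
    (x : 'rV[R[i]]_(data_dim ell)) p alpha (B T : R) :
  (forall k, normc (invmx (decimated_jacobian p x) alpha k) <= B) ->
  (forall k, normc (decimated_map p x 0 k) <= T) ->
  decimated_cond p x alpha <= (data_dim ell)%:R * (B * T).
Proof.
move=> hB hT; rewrite /decimated_cond.
rewrite (le_trans (ler_sum _ (fun k _ => ler_pM (normc_ge0 _) (normc_ge0 _) (hB k) (hT k)))) //.
by rewrite sumr_const card_ord mulr_natl.
Qed.

Theorem corollary3p1 (R : realType) (K : nat) (ell : 'I_K -> nat) (A : R)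
    (hK : (2 <= K)%N) (hell : forall i, (0 < ell i)%N) (hA : 0 < A) :
  exists C7 C8 : R,
    forall (x : 'rV[R[i]]_(data_dim ell)) (N : nat),
      (forall j, normc (node x j) = 1) ->
      (forall j, amp_top x j != 0) ->
      0 < eta x ->
      (forall j l, (l < ell j)%N -> normc (amp x j l) <= A) ->
      (data_dim ell <= N)%N ->
      N%:R * eta_star x < pi * (data_dim ell)%:R ->
      let p := (N %/ data_dim ell)%N in
      decimated_jacobian p x \in unitmx /\
      forall j : 'I_K,
        (forall l : nat, (l < ell j)%N ->
           decimated_cond p x (data_coord ell j l) <=
             C7 * (1 / eta_at x j) ^+ (data_dim ell - l) *
             (1 + normc (amp_prev x j l) / normc (amp_top x j)) *
             (1 / N%:R ^+ (data_dim ell + 1 - \max_(i < K) ell i))) /\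
        decimated_cond p x (data_coord ell j (ell j)) <=
          C8 * (1 / eta_at x j) ^+ (data_dim ell - ell j) *
          (1 / normc (amp_top x j)) *
          (1 / N%:R ^+ (data_dim ell + 1 - \max_(i < K) ell i)).
Proof.
set n := data_dim ell; set L := \max_(i < K) ell i.
pose Q : R := dual_const n.-1.
pose C := n%:R * (Q * (data_const ell A * (scaling_const n * 4 ^+ n))).
exists C, C => x N node1 top0 eta0 ampA nN no_wrap p.
have L_ge j : (ell j <= L)%N by exact: leq_bigmax.
have Ln : (L <= n)%N by apply/bigmax_leqP => j _; exact/ltnW/ell_le_dim.
have L0 : (0 < L)%N by have [j _] := exists_other (Ordinal hK) hK;
  apply: leq_trans (hell j) (L_ge j).
have n0 : (0 < n)%N by apply: leq_trans Ln.
have p0 : (0 < p)%N by rewrite divn_gt0.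
have [JU inv_le] := decimated_jacobian_inverse_bound node1 top0 hell p0
  (fun j => decimated_gap_bounds hK node1 eta0 n0 no_wrap j p0)
  (fun i j ij => decimated_separation node1 n0 no_wrap ij).
split=> // j; have {inv_le}[amp_le node_le] := inv_le j.
have map_le := fun k => decimated_map_le k (ltW hA) p0 node1 ampA.
have e0 := eta_at_gt0 eta0 j.
have L0n : (0 < L <= n)%N by rewrite L0.
have gain_le l : (l <= ell j)%N -> _ := fun lj => decimation_scaling nN L0n
  (leq_ltn_trans lj (ell_le_dim ell j)) e0 (no_wrap_eta_at hK no_wrap j).
set P := p%:R ^+ L.-1 in map_le gain_le.
set V := 1 / N%:R ^+ _.
have top_gt0 : 0 < normc (amp_top x j) by exact: normc_gt0.
have S0 : 0 <= scaling_const n :> R by rewrite /scaling_const !mulr_ge0 ?exprn_ge0 ?mulr_ge0.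
have D0 : 0 <= data_const ell A by rewrite /data_const !mulr_ge0 ?exprn_ge0 // ltW.
have V0 : 0 <= V by rewrite divr_ge0 ?exprn_ge0.
have E0 l : 0 <= (1 / eta_at x j) ^+ l by rewrite exprn_ge0 ?divr_ge0 ?ltW.
have B0 : 0 <= basis_const n.-1 :> R by rewrite exprn_ge0 ?addr_ge0 ?exprn_ge0.
have Q0 : 0 <= Q by rewrite mulr_ge0 ?exprn_ge0 ?addr_ge0.
split=> [l lj|].
  have lj' := ltnW lj.
  apply: (le_trans (decimated_cond_le (fun k => amp_le l k lj) map_le)).
  set r := normc _ / _; set g := (_ ^+ l * _)^-1; set h := (_ ^+ (ell j) * _)^-1.
  have r0 : 0 <= r by rewrite divr_ge0 ?normc_ge0.
  have gP : g * P <= scaling_const n * (1 / eta_at x j) ^+ (n - l) * V := gain_le l lj'.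
  (* The term of order ell j carries a smaller power of 1 / eta; the claim has a
     single power for both terms. *)
  have hP : h * P <= scaling_const n * (4 ^+ n * (1 / eta_at x j) ^+ (n - l)) * V.
    apply: (le_trans (gain_le _ (leqnn _))); rewrite -/V ler_wpM2r // ler_wpM2l //.
    by apply: scaling_weaken; rewrite ?lj' ?(ltnW (ell_le_dim ell j)) // e0 eta_at_le4.
  have gP4 : g * P <= scaling_const n * (4 ^+ n * (1 / eta_at x j) ^+ (n - l)) * V.
    apply: (le_trans gP); rewrite ler_wpM2r // ler_wpM2l //.
    by rewrite ler_peMl // exprn_ege1 // ler1n.
  rewrite [leLHS](_ : _ = n%:R * Q * data_const ell A * (g * P + r * (h * P)));
    last by rewrite -/n -/Q; ring.
  rewrite [leRHS](_ : _ = n%:R * Q * data_const ell A *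
     (scaling_const n * (4 ^+ n * (1 / eta_at x j) ^+ (n - l)) * V +
      r * (scaling_const n * (4 ^+ n * (1 / eta_at x j) ^+ (n - l)) * V)));
        last by rewrite /C; ring.
  apply: ler_wpM2l; first exact: mulr_ge0 (mulr_ge0 (ler0n _ _) Q0) D0.
  by apply: lerD => //; exact: ler_wpM2l.
apply: (le_trans (decimated_cond_le node_le map_le)).
set h := (_ ^+ (ell j) * _)^-1.
have hP : h * P <= scaling_const n * (4 ^+ n * (1 / eta_at x j) ^+ (n - ell j)) * V.
  apply: (le_trans (gain_le _ (leqnn _))); rewrite -/V ler_wpM2r // ler_wpM2l //.
  by rewrite ler_peMl // exprn_ege1 // ler1n.
rewrite [leLHS](_ : _ = n%:R * (Q / normc (amp_top x j)) * data_const ell A * (h * P));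
  last by rewrite -/n -/Q; ring.
rewrite [leRHS](_ : _ = n%:R * (Q / normc (amp_top x j)) * data_const ell A *
     (scaling_const n * (4 ^+ n * (1 / eta_at x j) ^+ (n - ell j)) * V)); last by rewrite /C; ring.
apply: ler_wpM2l => //; apply: mulr_ge0 D0; apply: mulr_ge0; first exact: ler0n.
by rewrite divr_ge0 // ltW.
Qed.
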